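(* Let $A$ be a left nilpotent skew brace of finite weight, i.e. $\omega(A)<\infty$, satisfying the descending chain condition on ideals. Then the minimal number of generators of $A$ as a strong left ideal (the minimal cardinality of a subset of $A$ that generates $A$ as a strong left ideal) coincides with $\omega(A)$.
   Context: A skew brace is a triple $(A,+,\circ)$ with $(A,+)$, $(A,\circ)$ groups (not necessarily abelian) and $a\circ(b+c)=a\circ b-a+a\circ c$. Put $\lambda_a(b)=-a+a\circ b$ and $a*b=-a+a\circ b-b$. For subsets $Y,Z\subseteq A$, $Y*Z$ is the subgroup of $(A,+)$ generated by all $y*z$ with $y\in Y$, $z\in Z$. The left series is $A^1=A$, $A^{n+1}=A*A^n$; $A$ is left nilpotent if $A^n=0$ for some $n$. A strong left ideal is a normal subgroup $I$ of $(A,+)$ with $\lambda_a(I)\subseteq I$ for all $a\in A$; an ideal is a strong left ideal that is also normal in $(A,\circ)$. A subset generates $A$ as a strong left ideal (respectively as an ideal) if the smallest strong left ideal (respectively ideal) of $A$ containing it is $A$. The weight $\omega(A)$ is the minimal (possibly infinite) cardinality of a subset of $A$ that generates $A$ as an ideal. *)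

(* Defs.v *)
From HB Require Import structures.
From mathcomp Require Import all_boot.
From mathcomp Require Import boolp classical_sets functions cardinality.

Set Implicit Arguments.
Unset Strict Implicit.
Unset Printing Implicit Defensive.

Local Open Scope classical_set_scope.
Local Open Scope card_scope.

(* The group (A, o) is the groupType structure of A, with a o b written        *)
(* (a * b)%g.  The group (A, +) need not be abelian, so MathComp's additive     *)
(* (commutative) structures do not apply: its operations and laws are fields.   *)
HB.mixin Record isSkewBrace A & Group A := {
  sbadd : A -> A -> A;
  sbzero : A;
  sbopp : A -> A;
  sbaddA : associative sbadd;
  sbadd0r : left_id sbzero sbadd;
  sbaddr0 : right_id sbzero sbadd;
  sbaddNr : left_inverse sbzero sbopp sbadd;
  sbaddrN : right_inverse sbzero sbopp sbadd;
  sbmulDr : forall a b c : A,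
    (a * sbadd b c)%g = sbadd (sbadd (a * b)%g (sbopp a)) (a * c)%g
}.

#[short(type="skewBraceType")]
HB.structure Definition SkewBrace := {A of isSkewBrace A & Group A}.

Declare Scope brace_scope.
Delimit Scope brace_scope with brace.
Notation "0" := sbzero : brace_scope.
Notation "a + b" := (sbadd a b) : brace_scope.
Notation "- a" := (sbopp a) : brace_scope.
Notation "a - b" := (sbadd a (sbopp b)) : brace_scope.
Local Open Scope brace_scope.

Section SkewBraceDefs.
Variable A : skewBraceType.
Implicit Types (a b x y : A) (X Y Z H I : set A).

Definition sblambda a b : A := - a + (a * b)%g.

Definition sbstar a b : A := - a + (a * b)%g - b.

Definition add_subgroup H : Prop :=
  [/\ H 0, forall x y, H x -> H y -> H (x + y) & forall x, H x -> H (- x)].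

Definition add_normal H : Prop :=
  add_subgroup H /\ forall a x, H x -> H (a + x - a).

Definition circ_subgroup H : Prop :=
  [/\ H 1%g, forall x y, H x -> H y -> H (x * y)%g
    & forall x, H x -> H (x^-1)%g].

Definition circ_normal H : Prop :=
  circ_subgroup H /\ forall a x, H x -> H (a * x * a^-1)%g.

Definition strong_left_ideal I : Prop :=
  add_normal I /\ forall a x, I x -> I (sblambda a x).

Definition ideal I : Prop := strong_left_ideal I /\ circ_normal I.

Definition star_set Y Z : set A :=
  smallest add_subgroup [set sbstar y z | y in Y & z in Z].

(* [left_series n] is A^{n+1}. *)
Definition left_series (n : nat) : set A :=
  iter n (star_set [set: A]) [set: A].

Definition left_nilpotent : Prop := exists n, left_series n = [set 0].

Definition dcc_ideals : Prop :=
  forall I : nat -> set A,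
    (forall n, ideal (I n)) -> (forall n, I n.+1 `<=` I n) ->
    exists n, forall m, (n <= m)%N -> I m = I n.

Definition generates_as_strong_left_ideal X : Prop :=
  smallest strong_left_ideal X = [set: A].

Definition generates_as_ideal X : Prop := smallest ideal X = [set: A].

End SkewBraceDefs.

Arguments left_nilpotent : clear implicits.
Arguments dcc_ideals : clear implicits.

(* The minimal cardinality of a set satisfying P: [Some n] if it is the finite  *)
(* number n, and [None] if no finite set satisfies P.                           *)
Definition min_card (T : Type) (P : set T -> Prop) : option nat :=
  match pselect (exists n, `[< exists2 X, P X & X #= `I_n >]) with
  | left exn => Some (ex_minn exn)
  | right _ => None
  end.

Lemma min_card_SomeP (T : Type) (P : set T -> Prop) (n : nat) :
  min_card P = Some n <->
  (exists2 X, P X & X #= `I_n) /\ (forall X, P X -> `I_n #<= X).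
Proof.
rewrite /min_card; case: pselect => [exn|nex]; last first.
  by split=> // -[[X PX Xn] _]; case: nex; exists n; apply/asboolP; exists X.
case: ex_minnP => m /asboolP exm mP; split=> [[<-]|[exX nP]].
  split=> // X PX; case: (pselect (finite_set X)) => [[k Xk]|infX].
    rewrite (card_le_eqr Xk) card_le_II.
    by apply: mP; apply/asboolP; exists X.
  apply: card_le_trans ((infiniteP _).1 infX).
  exact: subset_card_le.
congr Some; apply/eqP; rewrite eqn_leq.
rewrite mP/=; last exact/asboolP.
by case: exm => X /nP + Xm; rewrite (card_le_eqr Xm) card_le_II.
Qed.

Lemma min_card_NoneP (T : Type) (P : set T -> Prop) :
  min_card P = None <-> forall X, P X -> infinite_set X.
Proof.
rewrite /min_card; case: pselect => [exP|nex]; split=> //.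
  by case: (exP) => n /asboolP[X PX Xn] /(_ X PX) []; exists n.
by move=> _ X PX [n Xn]; apply: nex; exists n; apply/asboolP; exists X.
Qed.

Definition weight (A : skewBraceType) : option nat :=
  min_card (@generates_as_ideal A).

Definition strong_left_ideal_rank (A : skewBraceType) : option nat :=
  min_card (@generates_as_strong_left_ideal A).

(* Main.v *)
Require Import Defs.
From mathcomp Require Import all_boot.
From mathcomp Require Import boolp classical_sets.

(* A strong left ideal S with S + A^2 = A is A itself: since                   *)
(* a * (s + t) = a * s + s + a * t - s is congruent to a * t modulo S,         *)
(* S + A^n = A gives A^2 <= S + A^(n+1), hence S + A^(n+1) = A, and left       *)
(* nilpotency concludes.  As o and + agree modulo A^2, every normal subgroup   *)
(* of (A, +) containing A^2 is an ideal.  So if S contains a set that          *)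
(* generates A as an ideal, then S + A^2 = A and S = A: the generating sets    *)
(* of A as an ideal and as a strong left ideal are the same.                   *)

Set Implicit Arguments.
Unset Strict Implicit.
Unset Printing Implicit Defensive.

Local Open Scope classical_set_scope.
Local Open Scope brace_scope.

Section SkewBraceTheory.
Variable A : skewBraceType.
Implicit Types (a b c x y : A) (X Y Z H S T : set A).

(** [A^2] consists of non-generators for strong left ideals, as in Nakayama's lemma
    ([left_nilpotent_strong_left_ideal], by iterating [star_set_add_set]). Modulo [A^2] the
    difference between ideals and normal additive subgroups disappears ([add_normal_ideal]).
    Together these make the two generation predicates equal, hence also their minimal
    cardinalities. *)

Lemma sbaddKr a b : - a + (a + b) = b.
Proof. by rewrite sbaddA sbaddNr sbadd0r. Qed.

Lemma sbaddNKr a b : a + (- a + b) = b.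
Proof. by rewrite sbaddA sbaddrN sbadd0r. Qed.

Lemma sbaddrK a b : a + b - b = a.
Proof. by rewrite -sbaddA sbaddrN sbaddr0. Qed.

Lemma sbaddrNK a b : a - b + b = a.
Proof. by rewrite -sbaddA sbaddNr sbaddr0. Qed.

Lemma sbaddrI a b c : a + b = a + c -> b = c.
Proof. by move=> e; rewrite -[b](sbaddKr a) e sbaddKr. Qed.

Lemma sbopprK a : - - a = a.
Proof. by apply: (@sbaddrI (- a)); rewrite sbaddrN sbaddNr. Qed.

Lemma sbopprD a b : - (a + b) = - b - a.
Proof. by apply: (@sbaddrI (a + b)); rewrite sbaddrN sbaddA sbaddrK sbaddrN. Qed.

Lemma sbmul0 a : (a * 0)%g = a.
Proof.
have := sbmulDr a 0 0; rewrite sbadd0r -sbaddA -{1}[(a * 0)%g]sbaddr0.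
by move/sbaddrI => e; rewrite -[LHS](sbaddNKr a) -e sbaddr0.
Qed.

Lemma sbzeroE : 0 = 1%g :> A.
Proof. by rewrite -[LHS]mul1g sbmul0. Qed.

Lemma sbmulE a b : (a * b)%g = a + sbstar a b + b.
Proof. by rewrite /sbstar sbaddA sbaddrNK sbaddNKr. Qed.

Lemma sblambdaE a b : sblambda a b = sbstar a b + b.
Proof. by rewrite /sbstar sbaddrNK. Qed.

Lemma sbstarDr a b c :
  sbstar a (b + c) = sbstar a b + (b + sbstar a c - b).
Proof. by rewrite /sbstar sbmulDr sbopprD !sbaddA sbaddrNK. Qed.

Lemma smallest_add_subgroup X : add_subgroup (smallest (@add_subgroup A) X).
Proof.
split=> [|x y Hx Hy H HX|x Hx H HX].
- by move=> H [[]].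
- by case: (HX) => -[_ HD _] _; apply: HD; [apply: Hx|apply: Hy].
- by case: (HX) => -[_ _ HN] _; apply: HN; apply: Hx.
Qed.

Lemma smallest_strong_left_ideal X :
  strong_left_ideal (smallest (@strong_left_ideal A) X).
Proof.
split; [split; [split|]|].
- by move=> H [[[[]]]].
- move=> x y Hx Hy H HX; case: (HX) => -[[[_ HD _] _] _] _.
  by apply: HD; [apply: Hx|apply: Hy].
- by move=> x Hx H HX; case: (HX) => -[[[_ _ HN] _] _] _; apply: HN; apply: Hx.
- by move=> a x Hx H HX; case: (HX) => -[[_ HJ] _] _; apply: HJ; apply: Hx.
- by move=> a x Hx H HX; case: (HX) => -[_ HL] _; apply: HL; apply: Hx.
Qed.

Lemma star_set_add_subgroup Y Z : add_subgroup (star_set Y Z).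
Proof. exact: smallest_add_subgroup. Qed.

Lemma mem_star_set Y Z y z : Y y -> Z z -> star_set Y Z (sbstar y z).
Proof. by move=> Yy Zz; apply: sub_gen_smallest; exists y => //; exists z. Qed.

Lemma star_set_sub Y Z H : add_subgroup H ->
  (forall y z, Y y -> Z z -> H (sbstar y z)) -> star_set Y Z `<=` H.
Proof.
move=> gH HYZ; apply: smallest_sub => // _ [y Yy [z Zz <-]].
exact: HYZ.
Qed.

(** The identity [y * (b + z) = y * b + (b + y * z - b)] writes a conjugate of a generator as a
    combination of two generators; [b + z] must be allowed as right factor, so that factor ranges
    over all of [A]. *)
Lemma star_set_add_normal Y : add_normal (star_set Y [set: A]).
Proof.
have gYA := star_set_add_subgroup Y [set: A]; have [YA0 YAD YAN] := gYA.
split=> // a x YAx; move: x YAx a.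
(* The elements with all conjugates in [Y * A] form a subgroup, so generators suffice. *)
apply: (@star_set_sub _ _ [set x | forall a, star_set Y [set: A] (a + x - a)]).
  split=> [a|x y Jx Jy a|x Jx a] /=; first by rewrite sbaddr0 sbaddrN.
    have -> : a + (x + y) - a = (a + x - a) + (a + y - a).
      by rewrite !sbaddA sbaddrNK.
    exact: YAD.
  have -> : a - x - a = - (a + x - a) by rewrite !sbopprD sbopprK !sbaddA.
  exact: YAN.
move=> y z Yy _ b /=.
have -> : b + sbstar y z - b = - sbstar y b + sbstar y (b + z).
  by rewrite sbstarDr sbaddKr.
by apply: (YAD); [apply: YAN|]; apply: mem_star_set.
Qed.

Definition add_set S T : set A := [set x | exists s t, [/\ S s, T t & x = s + t]].

Lemma add_set_subgroup S T :
  add_normal S -> add_subgroup T -> add_subgroup (add_set S T).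
Proof.
move=> [[S0 SD SN] SJ] [T0 TD TN]; split.
- by exists 0, 0; rewrite sbadd0r.
- move=> _ _ [s [t [Ss Tt ->]]] [s' [t' [Ss' Tt' ->]]].
  exists (s + (t + s' - t)), (t + t'); split; [|exact: TD|].
    by apply: SD => //; apply: SJ.
  by rewrite !sbaddA sbaddrNK.
- move=> _ [s [t [Ss Tt ->]]]; exists (- t - s + t), (- t); split.
  + by rewrite -{2}[t]sbopprK; apply/SJ/SN.
  + exact: TN.
  + by rewrite sbopprD sbaddrK.
Qed.

Lemma add_set_normal S T :
  add_normal S -> add_normal T -> add_normal (add_set S T).
Proof.
move=> nS nT; split; first by apply: add_set_subgroup => //; case: nT.
move=> a _ [s [t [Ss Tt ->]]]; exists (a + s - a), (a + t - a); split.
- by case: nS => _; apply.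
- by case: nT => _; apply.
- by rewrite !sbaddA sbaddrNK.
Qed.

Lemma add_normal_ideal T :
  add_normal T -> star_set [set: A] [set: A] `<=` T -> ideal T.
Proof.
move=> nT sT; have [[T0 TD TN] TJ] := nT.
have Tstar a b : T (sbstar a b) by apply: sT; apply: mem_star_set.
(* The two inverses agree modulo [T]: expand [a o a^-1 = 0] as [a + a * a^-1 + a^-1]. *)
have TV a : T (a + a^-1%g).
  have e : a + a^-1%g = - (a + sbstar a a^-1%g - a).
    apply: (@sbaddrI (a + sbstar a a^-1%g - a)).
    by rewrite sbaddrN sbaddA sbaddrNK -sbmulE mulgV sbzeroE.
  by rewrite e; apply/TN/TJ.
have TM x y : T x -> T y -> T (x * y)%g.
  by move=> Tx Ty; rewrite sbmulE; apply: (TD) => //; apply: TD.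
split; split=> //.
- by move=> a x Tx; rewrite sblambdaE; apply: TD.
- split=> //; first by rewrite -sbzeroE.
  by move=> x Tx; rewrite -[(x^-1)%g](sbaddKr x); apply: TD => //; apply: TN.
- move=> a x Tx.
  (* Up to star terms, the circle conjugate is the additive conjugate of [x] followed by [a + a^-1],
     which is in [T] by [TV]. *)
  have -> : (a * x * a^-1)%g =
      (a + (sbstar a x + x + sbstar (a * x)%g a^-1%g) - a) + (a + a^-1%g).
    by rewrite (sbmulE (a * x)%g) {1}(sbmulE a x) !sbaddA !sbaddrNK.
  by apply: (TD) => //; apply: TJ; apply: (TD) => //; apply: TD.
Qed.

Lemma star_set_add_set S T : strong_left_ideal S ->
  star_set [set: A] (add_set S T) `<=` add_set S (star_set [set: A] T).
Proof.
move=> [nS SL]; have [[S0 SD SN] SJ] := nS.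
apply: star_set_sub; first exact/add_set_subgroup/star_set_add_subgroup.
move=> a _ _ [s [t [Ss Tt ->]]].
have Sas : S (sbstar a s) by apply: (SD); [apply: SL|apply: SN].
(* With [u = a * s] and [v = a * t], the element is [u + s + v - s]; normality of [S] lets [- s]
   pass to the left of [v]. *)
exists (sbstar a s + s + (sbstar a t - s - sbstar a t)), (sbstar a t).
split.
- by apply: (SD); [apply: SD|apply/SJ/SN].
- exact: mem_star_set.
- rewrite sbstarDr; move: (sbstar a s) (sbstar a t) => u v.
  by rewrite !sbaddA sbaddrNK.
Qed.

Lemma strong_left_ideal_left_series S (n : nat) : strong_left_ideal S ->
  add_set S (left_series 1) = setT -> add_set S (left_series n) = setT.
Proof.
move=> iS S1; elim: n => [|n IHn].
  rewrite -subTset => x _; exists 0, x.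
  by split; [case: iS => -[[]]| |rewrite sbadd0r].
have A2sub : left_series 1 `<=` add_set S (left_series n.+1).
  (* Only the right factor of [A^2 = A * A] is replaced by [S + A^(n+1)]. *)
  by rewrite [left_series 1]/(star_set setT setT) -{2}IHn; apply: star_set_add_set.
rewrite -subTset -S1 => _ [s [_ [Ss /A2sub[s' [t [Ss' Lt ->]]] ->]]].
exists (s + s'), t; split=> //; last by rewrite sbaddA.
by case: iS => -[[_ SD _] _] _; apply: SD.
Qed.

Lemma left_nilpotent_strong_left_ideal S : left_nilpotent A ->
  strong_left_ideal S -> add_set S (left_series 1) = setT -> S = setT.
Proof.
move=> [n An0] iS /(strong_left_ideal_left_series n iS).
rewrite An0 -!subTset => SA x /SA [s [_ [Ss -> ->]]].
by rewrite sbaddr0.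
Qed.

(** An ideal is a strong left ideal, which gives one direction. For the other, [S + A^2] is an ideal
    containing [X], where [S] is the strong left ideal generated by [X]. *)
Lemma generates_as_strong_left_idealE : left_nilpotent A ->
  @generates_as_strong_left_ideal A = @generates_as_ideal A.
Proof.
move=> nilA; apply/funext => X; apply/propext; split=> genX.
  rewrite /generates_as_ideal -subTset -genX; apply: sub_smallest2l.
  by move=> I [].
have iS := smallest_strong_left_ideal X.
apply: left_nilpotent_strong_left_ideal => //.
rewrite -subTset -genX; apply: smallest_sub.
  apply: add_normal_ideal.
    by apply: add_set_normal; [case: iS|exact: star_set_add_normal].
  by move=> x A2x; exists 0, x; split; [case: iS => -[[]]| |rewrite sbadd0r].
move=> x Xx; exists x, 0; rewrite sbaddr0; split=> //.
  exact: sub_gen_smallest.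
by case: (star_set_add_subgroup [set: A] [set: A]).
Qed.

End SkewBraceTheory.

Theorem corollary4p11 (A : skewBraceType) :
  left_nilpotent A -> weight A <> None -> dcc_ideals A ->
  strong_left_ideal_rank A = weight A.
Proof.
move=> nilA _ _; rewrite /strong_left_ideal_rank /weight.
by rewrite generates_as_strong_left_idealE.
Qed.
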